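(* Let $n\ge 2$, let $Q:=[0,\infty)^n$, and let $\Omega\subset Q$ be a compact connected set with non-empty interior whose boundary inside $\mathrm{int}(Q)$ is smooth (i.e. $\Omega\cap\mathrm{int}(Q)$ is a domain whose boundary $\partial\Omega\cap\mathrm{int}(Q)$ is a smooth hypersurface), and such that every outer normal $\nu$ to $\partial\Omega\cap\mathrm{int}(Q)$ has only non-negative coordinates. Let $f$ be a smooth function on $\Omega$ vanishing on $\partial Q$ (that is, on $\Omega\cap\partial Q$). Then $$\int_\Omega\frac{f^2}{|x|^2}\,dx\le\frac{4}{n^2}\int_\Omega|\nabla f|^2\,dx .$$
   Context: $|\cdot|$ is the Euclidean norm on $\mathbb{R}^n$ and $\mathrm{int}(Q)=(0,\infty)^n$ is the interior of $Q$. No boundary condition is imposed on $f$ on $\partial\Omega\cap\mathrm{int}(Q)$. Smooth on $\Omega$ means smooth up to the boundary. *)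

(* Defs.v *)
From HB Require Import structures.
From mathcomp Require Import all_boot all_order all_algebra.
From mathcomp Require Import all_classical all_reals all_analysis.

Set Implicit Arguments.
Unset Strict Implicit.
Unset Printing Implicit Defensive.

Import Order.TTheory GRing.Theory Num.Theory.
Import numFieldNormedType.Exports.

Local Open Scope classical_set_scope.
Local Open Scope ring_scope.

Fact measure_row_display : measure_display.
Proof. exact: default_measure_display. Qed.

Section measurable_row.
Context (R : realType) (n : nat).

Definition row_coor (i : 'I_n) (x : 'rV[R]_n) : measurableTypeR R := x ord0 i.

Let row_set0 : g_sigma_preimage row_coor set0.
Proof. exact: sigma_algebra0. Qed.

Let row_setC A : g_sigma_preimage row_coor A ->
  g_sigma_preimage row_coor (~` A).
Proof. exact: sigma_algebraC. Qed.

Let row_bigcup (F : _^nat) : (forall i, g_sigma_preimage row_coor (F i)) ->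
  g_sigma_preimage row_coor (\bigcup_i (F i)).
Proof. exact: sigma_algebra_bigcup. Qed.

(* The sigma-algebra generated by the coordinates, that is, the Borel sets
   of R^n; same construction as the library's for n.-tuple T. *)
HB.instance Definition _ := @isMeasurable.Build measure_row_display
  'rV[R]_n (g_sigma_preimage row_coor) row_set0 row_setC row_bigcup.

End measurable_row.

Section row_cons.
Context (R : realType) (n : nat).

Definition row_cons (p : measurableTypeR R * 'rV[R]_n) : 'rV[R]_n.+1 :=
  \row_i oapp (p.2 ord0) p.1 (unlift ord0 i).

Lemma measurable_row_coor (i : 'I_n) :
  measurable_fun [set: 'rV[R]_n] (row_coor i).
Proof.
move=> _ Y mY; rewrite setTI; apply: sub_sigma_algebra => /=.
rewrite -bigcup_seq/=; exists i => /=; first by rewrite mem_index_enum.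
by exists Y => //; rewrite setTI.
Qed.

Lemma measurable_fun_row_coorP d (T : measurableType d) (f : T -> 'rV[R]_n) :
  (forall i, measurable_fun [set: T] (row_coor i \o f)) ->
  measurable_fun [set: T] f.
Proof.
move=> mf _ A mA.
have : preimage_set_system [set: T] f (g_sigma_preimage (@row_coor R n))
    (setT `&` f @^-1` A).
  by exists A.
rewrite -g_sigma_preimage_comp; apply: smallest_sub.
  exact: sigma_algebra_measurable.
move=> B; rewrite -bigcup_seq => -[i _] [C mC <-]; exact: mf.
Qed.

End row_cons.

Lemma measurable_row_cons (R : realType) (n : nat) :
  measurable_fun [set: measurableTypeR R * 'rV[R]_n] (@row_cons R n).
Proof.
apply: measurable_fun_row_coorP => i.
case: (unliftP ord0 i) => [j ->|->].
  rewrite (_ : _ \o _ = row_coor j \o snd).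
    by apply: measurableT_comp => //; exact: measurable_row_coor.
  by apply/funext => -[x y]; rewrite /row_coor/= mxE liftK.
rewrite (_ : _ \o _ = fst) //.
by apply/funext => -[x y]; rewrite /row_coor/= mxE unlift_none.
Qed.

Section lebesgue_succ.
Context (R : realType) (n : nat).
Variable mu : {sigma_finite_measure set 'rV[R]_n -> \bar R}.

Let lebesgue1 : {sigma_finite_measure set (measurableTypeR R) -> \bar R} :=
  @lebesgue_measure R.

Definition lebesgue_succ : set 'rV[R]_n.+1 -> \bar R :=
  pushforward (lebesgue1 \x mu)%E (@row_cons R n).

Let m : {measure set 'rV[R]_n.+1 -> \bar R} :=
  measure_function_pushforward__canonical__measure_function_Measure
    (lebesgue1 \x mu)%E (@measurable_row_cons R n).

HB.instance Definition _ := Measure.copy lebesgue_succ m.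

Let lebesgue_succ_sigma_finite : sigma_finite setT lebesgue_succ.
Proof.
have /sigma_finiteP[F [TF ndF Foo]] := sigma_finiteT lebesgue1.
have /sigma_finiteP[G [TG ndG Goo]] := sigma_finiteT mu.
pose uncons (x : 'rV[R]_n.+1) : measurableTypeR R * 'rV[R]_n :=
  (x ord0 ord0, \row_j x ord0 (lift ord0 j)).
have consK : cancel (@row_cons R n) uncons.
  move=> [x y]; rewrite /uncons mxE unlift_none/=; congr pair.
  by apply/rowP => j; rewrite !mxE liftK.
have muncons : measurable_fun setT uncons.
  apply: measurable_fun_pair => /=; first exact: (measurable_row_coor ord0).
  apply: measurable_fun_row_coorP => j.
  rewrite (_ : _ \o _ = row_coor (lift ord0 j)); last first.
    by apply/funext => x; rewrite /row_coor/= mxE.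
  exact: measurable_row_coor.
exists (fun k => uncons @^-1` (F k `*` G k)).
  apply/seteqP; split=> // x _.
  have [i _ Fi] : (\bigcup_i F i) (uncons x).1 by rewrite -TF.
  have [j _ Gj] : (\bigcup_j G j) (uncons x).2 by rewrite -TG.
  exists (maxn i j) => //; split.
    by move: Fi; exact/subsetPset/ndF/leq_maxl.
  by move: Gj; exact/subsetPset/ndG/leq_maxr.
move=> k; have [mFk Fk] := Foo k; have [mGk Gk] := Goo k; split.
  rewrite -[X in measurable X]setTI; apply: muncons => //.
  exact: measurableX.
rewrite /lebesgue_succ /pushforward -comp_preimage.
rewrite (_ : uncons \o _ = id); last by apply/funext => p; exact: consK.
by rewrite preimage_id product_measure1E// lte_mul_pinfty// ge0_fin_numE.
Qed.

HB.instance Definition _ := Measure_isSigmaFinite.Build _ _ _ lebesgue_succ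
  lebesgue_succ_sigma_finite.

End lebesgue_succ.

Fixpoint lebesgue_rV (R : realType) (n : nat) :
    {sigma_finite_measure set 'rV[R]_n -> \bar R} :=
  match n with
  | 0 => \d_ (0 : 'rV[R]_0)
  | n.+1 => lebesgue_succ (lebesgue_rV R n)
  end.


Lemma lebesgue_rV_box (R : realType) (n : nat) (a b : 'rV[R]_n) :
  (forall i, a ord0 i <= b ord0 i) ->
  lebesgue_rV R n [set x | forall i, a ord0 i <= x ord0 i <= b ord0 i] =
  (\prod_i (b ord0 i - a ord0 i))%:E.
Proof.
elim: n a b => [|n IHn] a b ab /=.
  by rewrite big_ord0 diracE mem_set//= => -[].
pose tl (x : 'rV[R]_n.+1) : 'rV[R]_n := \row_j x ord0 (lift ord0 j).
rewrite /lebesgue_succ /pushforward/=.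
rewrite (_ : @row_cons R n @^-1` _ = `[a ord0 ord0, b ord0 ord0] `*`
  [set x : 'rV[R]_n | forall i, tl a ord0 i <= x ord0 i <= tl b ord0 i]);
  last first.
  apply/seteqP; split=> -[x y] /=.
    move=> h; split => [|j].
      by have := h ord0; rewrite mxE unlift_none/= in_itv.
    by have := h (lift ord0 j); rewrite !mxE liftK.
  rewrite in_itv/= => -[hx hy] i.
  case: (unliftP ord0 i) => [j ->|->]; rewrite mxE ?unlift_none ?liftK//=.
  by have := hy j; rewrite !mxE.
rewrite product_measure1E//.
- have L : lebesgue_measure `[a ord0 ord0, b ord0 ord0]%classic =
      (b ord0 ord0 - a ord0 ord0)%:E :> \bar R.
    rewrite lebesgue_measure_itv/= lte_fin.
    have := ab ord0; rewrite le_eqVlt => /predU1P[->|->].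
      by rewrite ltxx subrr.
    by rewrite -EFinB.
  rewrite [X in (X * _)%E]L IHn; last by move=> i; rewrite !mxE.
  by rewrite -EFinM big_ord_recl; under eq_bigr do rewrite !mxE.
- rewrite (_ : [set _ | _] = \bigcap_(i in [set: 'I_n])
      (row_coor i @^-1` `[tl a ord0 i, tl b ord0 i])); last first.
    apply/seteqP; split=> x /= h i; first by move=> _; rewrite /= in_itv/= h.
    by have := h i Logic.I; rewrite /= in_itv.
  apply: fin_bigcap_measurable => // i _.
  by rewrite -[X in measurable X]setTI; exact: measurable_row_coor.
Qed.

Section euclidean_space.
Context (R : realType) (n : nat).
Implicit Types (A U : set 'rV[R]_n) (x p nu : 'rV[R]_n) (f rho : 'rV[R]_n -> R).

(* The library norm on 'rV[R]_n is the sup norm; it induces the same topology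
   and the same derivatives as the Euclidean one. *)
Definition enorm x : R := Num.sqrt (\sum_i x ord0 i ^+ 2).

Definition partial (i : 'I_n) f : 'rV[R]_n -> R :=
  fun x => 'D_(delta_mx ord0 i) f x.

Definition iter_partial (s : seq 'I_n) f : 'rV[R]_n -> R := foldr partial f s.

(* 'D_v f x is a total operator: where f is not derivable it has no meaning.
   For f smooth up to the boundary of A, grad f is the gradient on A°; its
   values on the boundary of A do not affect integrals over A as soon as this
   boundary is Lebesgue-null. *)
Definition grad f x : 'rV[R]_n := \row_i partial i f x.

(* C^oo on the open set U. *)
Definition smooth_on U f : Prop :=
  forall (s : seq 'I_n) x, U x -> differentiable (iter_partial s f) x.

(* C^oo in the interior of A, with f and all its partial derivatives extending
   continuously to the whole of A. Restrictions to A of functions that are C^oo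
   in a neighbourhood of A satisfy this. The values of f outside A play no
   role. *)
Definition smooth_up_to_boundary A f : Prop :=
  [/\ {within A, continuous f}, smooth_on A° f &
      forall s : seq 'I_n, exists2 g : 'rV[R]_n -> R,
        {within A, continuous g} & forall x, A° x -> g x = iter_partial s f x].

Definition boundary A : set 'rV[R]_n := closure A `\` A°.

Definition orthant : set 'rV[R]_n := [set x | forall i, 0 <= x ord0 i].

Definition open_orthant : set 'rV[R]_n := [set x | forall i, 0 < x ord0 i].

(* rho is a smooth local equation of A at p: near p, the set A is the region
   lying on one side of the hypersurface rho = 0. *)
Definition local_defining A p U rho : Prop :=
  [/\ open U, U p, smooth_on U rho, grad rho p != 0 &
      A `&` U = [set x | U x /\ rho x <= 0]].

Definition smooth_boundary_at A p : Prop :=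
  exists U rho, local_defining A p U rho.

Definition outer_normal A p nu : Prop :=
  exists U rho, local_defining A p U rho /\
    nu = (enorm (grad rho p))^-1 *: grad rho p.

End euclidean_space.

Arguments orthant {R n}.
Arguments open_orthant {R n}.

(* Main.v *)
Require Import Defs.
From mathcomp Require Import all_boot all_order all_algebra.
From mathcomp Require Import all_classical all_reals all_analysis.
From mathcomp Require Import measurable_realfun ring lra.

Import Order.TTheory GRing.Theory Num.Theory.
Import numFieldNormedType.Exports.

Local Open Scope classical_set_scope.
Local Open Scope ring_scope.

(** The inequality follows from the one-dimensional Hardy inequality in each
    coordinate direction.

    Since the outer normals have non-negative coordinates, a direction d all of
    whose coordinates are negative points strictly into Omega at every boundary
    point inside the open orthant.  A segment that starts in Omega and has such
    a direction can therefore not leave Omega while it stays in the open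
    orthant; letting d tend to a direction with non-positive coordinates shows
    that Omega is down-closed in the open orthant ([down_closed]).  So every
    line parallel to a coordinate axis meets the interior of Omega in an
    interval ]0, b[, where t is the coordinate along the axis
    ([interior_section]).  The function f vanishes at the end t = 0 of this
    interval and is free at the other end, which is exactly the situation of
    the inequality
      int_0^b (h / t)^2 dt <= 4 int_0^b (h')^2 dt     for h(0) = 0
    ([hardy_itv]).  Integrating it over all lines with direction e_i gives
      int (f / x_i)^2 <= 4 int (d_i f)^2
    on the interior of Omega ([hardy_direction]).  Summing over i turns the
    right-hand sides into 4 int |grad f|^2, and on the left
    n^2 / |x|^2 <= sum_i 1 / x_i^2 by Cauchy-Schwarz ([inv_enorm_sqr_le]); this
    is the stated inequality on the interior of Omega ([hardy_interior]).

    It remains to see that the boundary of Omega does not contribute to the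
    left-hand side.  On the boundary of the orthant f = 0.  At a boundary point
    p inside the open orthant some coordinate j of the normal is positive, so
    that p + t e_j is outside Omega for all t > 0; by down-closedness, a line
    with direction e_j contains at most one such point.  These points thus form
    a null set ([exit_set_null]). *)

(** * Measurability and integrals *)

(** The integral of a non-negative function is a supremum over simple functions
    below it, hence monotone in the domain even when the function is not
    measurable.  This covers the gradient, whose values on the boundary of the
    domain are arbitrary. *)
Lemma le_integral_subset (R : realType) d (T : measurableType d)
    (mu : {measure set T -> \bar R}) (A B : set T) (g : T -> \bar R) :
  A `<=` B -> (forall x, B x -> 0 <= g x)%E ->
  (\int[mu]_(x in A) g x <= \int[mu]_(x in B) g x)%E.
Proof.
move=> AB g0.
have gA x : (0 <= (g \_ A) x)%E by apply: erestrict_ge0 => z /AB; exact: g0.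
have gB x : (0 <= (g \_ B) x)%E by exact: erestrict_ge0.
rewrite (integral_mkcond A) (integral_mkcond B) !ge0_integralTE//.
apply: le_ereal_sup => _ [h hA <-]; exists h => // x.
apply: le_trans (hA x) _; rewrite /patch.
case: ifPn => [xA|_]; last by case: ifPn => // /set_mem/g0.
by rewrite ifT// inE; apply: AB; rewrite -inE.
Qed.

Section rV_measurability.
Context {R : realType} {n : nat}.
Implicit Types (U A : set 'rV[R]_n).

Lemma nbhs_rVP (x : 'rV[R]_n) (U : set 'rV[R]_n) :
  nbhs x U <->
  exists2 e : R, 0 < e & forall y : 'rV[R]_n,
    (forall i, `|x ord0 i - y ord0 i| < e) -> U y.
Proof.
split=> [/nbhs_ballP[e /= e0 xeU]|[e e0 xeU]].
  exists e => // y xy; apply: xeU; split=> // i j.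
  by rewrite (ord1 i); exact: xy.
apply/nbhs_ballP; exists e => // y [_ xy]; apply: xeU => i; exact: xy.
Qed.

(** The sigma-algebra generated by the coordinates contains the open sets: such
    a set is the union of the countably many cubes with rational centre and
    radius 1 / (k + 1) that it contains. *)
Lemma open_measurable_rV U : open U -> measurable U.
Proof.
move=> oU.
pose box (q : 'rV[rat]_n * nat) : set 'rV[R]_n :=
  [set x | forall i, `|ratr (q.1 ord0 i) - x ord0 i| < q.2.+1%:R^-1].
pose D := [set q | box q `<=` U].
have -> : U = \bigcup_(q in D) box q.
  apply/seteqP; split=> [x Ux|x [q Dq]]; last exact: Dq.
  have /nbhs_rVP[e e0 xeU] : nbhs x U by exact: open_nbhs_nbhs.
  (* A cube of radius less than e / 2 that contains x lies within e of x. *)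
  pose k := `|Num.ceil (2 / e)|%N.
  have k_gt : 2 / k.+1%:R < e.
    rewrite ltr_pdivrMr// mulrC -ltr_pdivrMr//.
    rewrite (le_lt_trans (ceil_ge _))// -[in ltRHS]natr1 /k.
    rewrite natr_absz ger0_norm ?ltrDl// -(ler_int R).
    by rewrite (le_trans _ (ceil_ge _))// divr_ge0// ltW.
  have qx (i : 'I_n) : {q : rat | `|ratr q - x ord0 i| < k.+1%:R^-1}.
    apply: cid; have [|q] :=
        @rat_in_itvoo R (x ord0 i - k.+1%:R^-1) (x ord0 i + k.+1%:R^-1).
      by rewrite ltrD2l gtrN// invr_gt0.
    by rewrite in_itv/= => q_itv; exists q; rewrite ltr_distl.
  exists (\row_i sval (qx i), k) => [y yq|i] /=; last first.
    by rewrite mxE; case: (qx i).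
  apply: xeU => i; rewrite (lt_trans _ k_gt)//.
  rewrite (splitr (2 / _)) [_ / 2]mulrAC divff ?pnatr_eq0// mul1r.
  rewrite -(subrKA (ratr (sval (qx i)))) (le_lt_trans (ler_normD _ _))// ltrD//.
    by rewrite distrC; case: (qx i).
  by have := yq i; rewrite /= mxE.
rewrite bigcup_mkcond; apply: countable_bigcupT_measurable => [|q].
  exact: countableP.
case: ifP => // _.
rewrite (_ : box q = \bigcap_(i in [set: 'I_n])
    (row_coor i @^-1` (ball (ratr (q.1 ord0 i) : R) q.2.+1%:R^-1))); last first.
  by apply/seteqP; split=> x h i; [move=> _; exact: h|exact: (h i)].
apply: fin_bigcap_measurable => // i _.
rewrite -[X in measurable X]setTI; apply: measurable_row_coor => //.
by apply: open_measurable; apply: ball_open; rewrite invr_gt0.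
Qed.

Lemma closed_measurable_rV U : closed U -> measurable U.
Proof.
move=> cU; rewrite -(setCK U); apply: measurableC; apply: open_measurable_rV.
by rewrite openC.
Qed.

Lemma within_continuous_measurable_rV A (g : 'rV[R]_n -> R) : measurable A ->
  {within A, continuous g} -> measurable_fun A g.
Proof.
move=> mA /continuousP cg.
apply: (measurability _ (RGenOpens.measurableE R)) => _ [_ [a [b ->] <-]].
have := cg _ (interval_open (a := BRight a) (b := BLeft b) isT isT).
move=> /open_subspaceP[V oV VA].
rewrite setIC -VA; apply: measurableI => //; exact: open_measurable_rV.
Qed.

Lemma open_continuous_measurable_rV (U : set 'rV[R]_n) (g : 'rV[R]_n -> R) :
  open U -> {in U, continuous g} -> measurable_fun U g.
Proof.
move=> oU cg; apply: within_continuous_measurable_rV.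
  exact: open_measurable_rV.
by rewrite continuous_open_subspace.
Qed.

End rV_measurability.

(** * Integration along coordinate lines *)

Section slicing.
Context {R : realType}.
Local Open Scope ereal_scope.

(** A point of the line in direction i is described by its coordinate t on that
    line and by the vector y of its other coordinates. *)
Definition row_insert {n : nat} (i : 'I_n.+1)
    (p : measurableTypeR R * 'rV[R]_n) : 'rV[R]_n.+1 :=
  \row_k oapp (p.2 ord0) p.1 (unlift i k).

Lemma row_insert_at n (i : 'I_n.+1) t (y : 'rV[R]_n) :
  row_insert i (t, y) ord0 i = t.
Proof. by rewrite mxE unlift_none. Qed.

Lemma row_insert_lift n (i : 'I_n.+1) t (y : 'rV[R]_n) (k : 'I_n) :
  row_insert i (t, y) ord0 (lift i k) = y ord0 k.
Proof. by rewrite mxE liftK. Qed.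

Lemma measurable_row_insert n (i : 'I_n.+1) :
  measurable_fun setT (@row_insert n i).
Proof.
apply: measurable_fun_row_coorP => k.
case: (unliftP i k) => [j ->|->].
  rewrite (_ : _ \o _ = row_coor j \o snd).
    by apply: measurableT_comp => //; exact: measurable_row_coor.
  by apply/funext => -[x y]; rewrite /row_coor/= row_insert_lift.
rewrite (_ : _ \o _ = fst) //.
by apply/funext => -[x y]; rewrite /row_coor/= row_insert_at.
Qed.

Lemma row_insert_cons n (i : 'I_n.+1) s t (y : 'rV[R]_n) :
  row_insert (lift ord0 i) (t, row_insert ord0 (s, y)) =
  row_insert ord0 (s, row_insert i (t, y)) :> 'rV[R]_n.+2.
Proof.
apply/rowP => k; case: (unliftP ord0 k) => [k'|] ->.
  rewrite row_insert_lift; case: (unliftP i k') => [j|] ->.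
    rewrite row_insert_lift.
    rewrite (_ : lift ord0 (lift i j) = lift (lift ord0 i) (lift ord0 j)).
      by rewrite !row_insert_lift.
    by apply/val_inj; rewrite /= /bump /= !add1n ltnS addnS.
  by rewrite !row_insert_at.
rewrite row_insert_at.
transitivity (row_insert (lift ord0 i) (t, row_insert ord0 (s, y)) ord0
    (lift (lift ord0 i) ord0)); last by rewrite row_insert_lift row_insert_at.
by congr (row_insert _ _ _ _); exact/val_inj.
Qed.

Lemma measurable_slice n (i : 'I_n.+1) (F : 'rV[R]_n.+1 -> \bar R) :
  measurable_fun setT F -> (forall x, 0 <= F x) ->
  measurable_fun setT
    (fun y : 'rV[R]_n => \int[lebesgue_measure]_t F (row_insert i (t, y))).
Proof.
move=> mF F0.
apply: (measurable_fun_fubini_tonelli_G (F \o row_insert i)) => [|p].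
  apply: measurableT_comp => //; exact: measurable_row_insert.
exact: F0.
Qed.

Lemma integral_rVS n (F : 'rV[R]_n.+1 -> \bar R) :
  measurable_fun setT F -> (forall x, 0 <= F x) ->
  \int[lebesgue_rV R n.+1]_x F x =
  \int[(@lebesgue_measure R \x lebesgue_rV R n)%E]_p F (row_insert ord0 p).
Proof.
move=> mF F0.
by rewrite -[RHS](ge0_integral_pushforward (@measurable_row_cons R n) _
  measurableT).
Qed.

(** The measure splits off its first coordinate by construction.  For another
    coordinate i, split off the first one, apply the induction hypothesis to
    the remaining space, and put the first coordinate back. *)
Lemma integral_slice n (i : 'I_n.+1) (F : 'rV[R]_n.+1 -> \bar R) :
  measurable_fun setT F -> (forall x, 0 <= F x) ->
  \int[lebesgue_rV R n.+1]_x F x =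
  \int[lebesgue_rV R n]_y \int[lebesgue_measure]_t F (row_insert i (t, y)).
Proof.
elim: n i F => [|n IHn] i F mF F0.
  have mFi : measurable_fun setT (F \o row_insert ord0).
    by apply: measurableT_comp; [exact: mF|exact: measurable_row_insert].
  rewrite (integral_rVS 0 _ mF F0) (ord1 i).
  by rewrite (fubini_tonelli2 (F \o row_insert ord0) mFi (fun p => F0 _)).
have mFi k : measurable_fun setT (F \o row_insert k).
  by apply: measurableT_comp; [exact: mF|exact: measurable_row_insert].
rewrite (integral_rVS n.+1 _ mF F0).
case: (unliftP ord0 i) => [j|] ->; last first.
  by rewrite (fubini_tonelli2 (F \o row_insert ord0) (mFi _) (fun p => F0 _)).
rewrite (fubini_tonelli1 (F \o row_insert ord0) (mFi _) (fun p => F0 _)).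
pose G (y : 'rV[R]_n.+1) :=
  \int[lebesgue_measure]_t F (row_insert (lift ord0 j) (t, y)).
have mG : measurable_fun setT G by exact: measurable_slice.
have G0 y : 0 <= G y by exact: integral_ge0.
have mGi : measurable_fun setT (G \o row_insert ord0).
  by apply: measurableT_comp; [exact: mG|exact: measurable_row_insert].
rewrite (integral_rVS n _ mG G0).
rewrite (fubini_tonelli1 (G \o row_insert ord0) mGi (fun p => G0 _)).
apply: eq_integral => s _; rewrite /fubini_F /= (IHn j).
- apply: eq_integral => y _; apply: eq_integral => t _.
  by rewrite row_insert_cons.
- apply: (measurableT_comp (mFi ord0)).
  exact: measurable_pair1.
- by move=> y; exact: F0.
Qed.

End slicing.

(** * The Hardy inequality on an interval *)

Section hardy_line.
Context {R : realType}.
Notation mu := (@lebesgue_measure R).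

Let continuous_sqr (D : {pred R}) (u : R -> R) :
  {in D, continuous u} -> {in D, continuous (fun t => u t ^+ 2)}.
Proof.
move=> cu t tD.
exact: (@continuous_comp _ _ _ u (fun x => x ^+ 2) t (cu t tD)
  (@exprn_continuous R 2 _)).
Qed.

(** The derivative of F(t) = - 2 h^2 / t is 2 (h / t)^2 - 4 (h / t) h', and
    (h / t)^2 <= 4 h'^2 + F' because the difference of the two sides is the
    square of h / t - 2 h'.  Integrating F' produces the boundary term at a; the
    one at c has the favourable sign, so that h is free at this end. *)
Lemma hardy_segment (a c : R) (h h' : R -> R) : 0 < a -> a < c ->
  {in `[a, c], forall t, is_derive (t : R) 1 h (h' t)} ->
  {in `[a, c], continuous h'} ->
  (\int[mu]_(t in `[a, c]) ((h t / t) ^+ 2)%:E <=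
   \int[mu]_(t in `[a, c]) (4 * h' t ^+ 2)%:E + (2 * (h a ^+ 2 / a))%:E)%E.
Proof.
move=> a0 ac dh ch'.
have pos t : t \in `[a, c] -> 0 < t.
  by rewrite in_itv/= => /andP[/(lt_le_trans a0)].
have ch : {in `[a, c], continuous h}.
  move=> t tac; apply: differentiable_continuous.
  by rewrite -derivable1_diffP; have [] := dh _ tac.
have cinv : {in `[a, c], continuous (fun t : R => t^-1)}.
  by move=> t tac; apply: inv_continuous; rewrite gt_eqF// pos.
pose F t := - 2 * (h t ^+ 2 * t^-1).
pose g t := 2 * (h t / t) ^+ 2 - 4 * (h t / t * h' t).
have chV : {in `[a, c], continuous (fun t => h t / t)}.
  by move=> t tac; apply: cvgM; [exact: ch|exact: cinv].
have wint (u : R -> R) : {in `[a, c], continuous u} ->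
    mu.-integrable `[a, c] (EFin \o u).
  move=> cu; apply: continuous_compact_integrable.
    exact: segment_compact.
  by apply: continuous_in_subspaceT => t; rewrite inE/=; exact: cu.
have cg : {in `[a, c], continuous g}.
  move=> t tac; apply: cvgB; apply: cvgM; first exact: cvg_cst.
  - exact: continuous_sqr chV _ tac.
  - exact: cvg_cst.
  - by apply: cvgM; [exact: chV|exact: ch'].
have cv : {in `[a, c], continuous (fun t => 4 * h' t ^+ 2)}.
  move=> t tac; apply: cvgM; first exact: cvg_cst.
  exact: continuous_sqr ch' _ tac.
have cu := continuous_sqr _ _ chV.
have dF : {in `[a, c], forall t, is_derive (t : R) 1 F (g t)}.
  move=> t tac; have t0 := pos _ tac.
  have dht := dh _ tac.
  have dV : is_derive t 1 (fun t : R => t^-1) (- t ^- 2 *: 1).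
    apply: DeriveDef; first by apply: derivableV; rewrite ?gt_eqF.
    by rewrite deriveV ?gt_eqF// derive_id.
  have d2 := is_deriveX 2 dht.
  have dM := is_deriveM d2 dV.
  have dZ := is_deriveZ (- 2) dM.
  have -> : F = (- 2) \*: ((h ^+ 2) * (fun t : R => t^-1)) by exact/funext.
  apply: (is_derive_eq dZ).
  rewrite (_ : (h ^+ 2) t = h t ^+ 2)// /g /GRing.scale/= expr1; field.
  by rewrite gt_eqF.
have FTC : (\int[mu]_(t in `[a, c]) (g t)%:E = (F c)%:E - (F a)%:E)%E.
  apply: continuous_FTC2 => //.
  - by apply: continuous_in_subspaceT => t; rewrite inE/=; exact: cg.
  - have cF : {in `[a, c], continuous F}.
      move=> t tac; apply: differentiable_continuous.
      by rewrite -derivable1_diffP; have [] := dF _ tac.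
    split.
    + by move=> t tac; have [] := dF _ (subset_itv_oo_cc tac).
    + apply: cvg_at_right_filter; apply: cF; rewrite in_itv/= lexx; exact: ltW.
    + apply: cvg_at_left_filter; apply: cF; rewrite in_itv/= lexx andbT.
      exact: ltW.
  - by move=> t tac; rewrite derive1E; have [] := dF _ (subset_itv_oo_cc tac).
apply: (@le_trans _ _ (\int[mu]_(t in `[a, c]) (4 * h' t ^+ 2 + g t)%:E)%E).
  apply: le_integral => //; first exact: wint.
    apply: (wint (fun t => 4 * h' t ^+ 2 + g t)) => t tac.
    by apply: cvgD; [exact: cv|exact: cg].
  move=> t _; rewrite lee_fin /g -subr_ge0.
  rewrite (_ : _ - _ = (h t / t - 2 * h' t) ^+ 2) ?sqr_ge0//.
  by ring.
rewrite integralD_EFin//; [|exact: wint|exact: wint].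
rewrite leeD2l// FTC -EFinB lee_fin /F.
have : 0 <= h c ^+ 2 / c by rewrite divr_ge0 ?sqr_ge0// ltW// (lt_trans a0).
lra.
Qed.

(** Exhaust ]0, b[ by segments.  The bound |h| <= M t is the form in which
    h(0) = 0 enters: the boundary term 2 h(a)^2 / a is at most 2 M^2 a, which
    tends to 0 with a. *)
Lemma hardy_itv (b M : R) (h h' : R -> R) :
  {in `]0, b[, forall t, is_derive (t : R) 1 h (h' t)} ->
  {in `]0, b[, continuous h'} ->
  {in `]0, b[, forall t, `|h t| <= M * t} ->
  (\int[mu]_(t in `]0%R, b[) ((h t / t) ^+ 2)%:E <=
   \int[mu]_(t in `]0%R, b[) (4 * h' t ^+ 2)%:E)%E.
Proof.
move=> dh ch' hM.
have [b0|b0] := leP b 0.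
  by rewrite set_itv_ge ?integral_set0// bnd_simp -leNgt.
(* With the denominator k + 3 the segment is not empty, even for k = 0. *)
pose e k : R := b / k.+3%:R.
have e0 k : 0 < e k by rewrite divr_gt0.
have e_lt k : e k < b - e k.
  rewrite ltrBrDl -mulr2n -mulr_natr /e -mulrA gtr_pMr//.
  by rewrite mulrC ltr_pdivrMr// mul1r ltr_nat.
pose F k : set R := `[e k, b - e k]%classic.
have Fsub k : F k `<=` `]0, b[.
  move=> t; rewrite /F /= !in_itv/= => /andP[et tb].
  by rewrite (lt_le_trans (e0 k))//= (le_lt_trans tb)// gtrBl.
have e_ni k l : (k <= l)%N -> e l <= e k.
  by move=> kl; rewrite /e ler_pM2l// lef_pV2 ?posrE// ler_nat.
have ch : {in `]0, b[, continuous h}.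
  move=> t tb; apply: differentiable_continuous.
  by rewrite -derivable1_diffP; have [] := dh _ tb.
have mu' : measurable_fun `]0, b[ (fun t => ((h t / t) ^+ 2)%:E).
  apply/measurable_EFinP; apply: open_continuous_measurable_fun => // t.
  rewrite inE/=; move: t; apply: continuous_sqr => t tb.
  apply: cvgM; first exact: ch.
  apply: inv_continuous; rewrite gt_eqF//.
  by move: tb; rewrite in_itv/= => /andP[].
have mv : measurable_fun `]0, b[ (fun t => (4 * h' t ^+ 2)%:E).
  apply/measurable_EFinP; apply: open_continuous_measurable_fun => // t.
  rewrite inE/= => tb; apply: cvgM; first exact: cvg_cst.
  exact: continuous_sqr ch' _ tb.
have Fcup : \bigcup_k F k = `]0, b[%classic.
  apply/seteqP; split=> [t [k _]|t]; first exact: Fsub.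
  rewrite /= in_itv/= => /andP[t0 tb].
  pose m := Num.min t (b - t).
  have m0 : 0 < m by rewrite lt_min t0 subr_gt0.
  have [k km] : exists k, e k <= m.
    exists (Num.truncn (b / m)); rewrite /e ler_pdivrMr// mulrC -ler_pdivrMr//.
    apply/ltW; apply: lt_trans (truncnS_gt _) _.
    by rewrite ltr_nat.
  exists k => //; rewrite /F/= in_itv/=.
  move: km; rewrite le_min => /andP[-> kb]/=; lra.
have : (\int[mu]_(t in F k) ((h t / t) ^+ 2)%:E @[k --> \oo] -->
        \int[mu]_(t in `]0%R, b[) ((h t / t) ^+ 2)%:E)%E.
  rewrite -Fcup; apply: ge0_nondecreasing_set_cvg_integral.
  - move=> k l kl; apply/subsetPset => t.
    rewrite /F/= !in_itv/= => /andP[et tb].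
    by rewrite (le_trans (e_ni _ _ kl) et) (le_trans tb)// lerB// e_ni.
  - by move=> k; exact: measurable_itv.
  - by move=> k; apply: measurable_funS mu' => //; exact: Fsub.
  - by move=> k t _; rewrite lee_fin sqr_ge0.
move=> cvgu; rewrite -(cvg_lim _ cvgu)//.
have bound k : (\int[mu]_(t in F k) ((h t / t) ^+ 2)%:E <=
   \int[mu]_(t in `]0%R, b[) (4 * h' t ^+ 2)%:E + (2 * M ^+ 2 * e k)%:E)%E.
  have sub t : t \in `[e k, b - e k] -> t \in `]0, b[ by move=> /Fsub.
  apply: le_trans (hardy_segment (e k) (b - e k) h h' (e0 k) (e_lt k) _ _) _.
  - by move=> t /sub; exact: dh.
  - by move=> t /sub; exact: ch'.
  apply: leeD.
    apply: ge0_subset_integral => //.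
    by move=> t _; rewrite lee_fin mulr_ge0// sqr_ge0.
  have hM_e : `|h (e k)| <= M * e k.
    by rewrite hM// in_itv/= e0/=; have := e_lt k; have := e0 k; lra.
  rewrite lee_fin -mulrA ler_pM2l// ler_pdivrMr// -mulrA -expr2 -exprMn.
  rewrite -[leLHS]real_normK ?num_real// lerXn2r ?nnegrE//.
  by rewrite (le_trans (normr_ge0 (h (e k)))).
apply/lee_addgt0Pr => d d0; apply: lime_le; first exact: cvgP cvgu.
pose K := Num.truncn (2 * M ^+ 2 * b / d).
near=> k; apply: le_trans (bound k) _; rewrite leeD2l// lee_fin.
apply: (@le_trans _ _ (2 * M ^+ 2 * e K)).
  apply: ler_wpM2l; first by rewrite mulr_ge0 ?sqr_ge0.
  by apply: e_ni; near: k; exact: nbhs_infty_ge.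
rewrite /e mulrA ler_pdivrMr// [leRHS]mulrC -ler_pdivrMr//.
apply/ltW; apply: lt_trans (truncnS_gt _) _.
by rewrite ltr_nat.
Unshelve. all: by end_near. Qed.

End hardy_line.

(** * Lines in the space *)

Lemma at_right0_itv {R : realType} (P : set R) : (\forall t \near 0^'+, P t) ->
  exists2 e : R, 0 < e & forall t, 0 < t < e -> P t.
Proof.
move=> /nbhs_ballP[e /= e0 eP]; exists e => // t /andP[t0 te].
by apply: eP => //; rewrite /ball/= sub0r normrN gtr0_norm.
Qed.

Section directional_derivative.
Context {R : realType} {n : nat}.
Implicit Types (f rho : 'rV[R]_n -> R) (p d : 'rV[R]_n).

Lemma derive_grad f p d : differentiable f p ->
  'D_d f p = \sum_i d ord0 i * grad f p ord0 i.
Proof.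
move=> df; rewrite deriveE// {1}(row_sum_delta d) linear_sum/=.
apply: eq_bigr => i _; rewrite linearZ/= mxE /partial deriveE//.
Qed.

Lemma derive_lt0_near f p d : derivable f p d -> 'D_d f p < 0 ->
  \forall t \near 0^'+, f (p + t *: d) < f p.
Proof.
move=> df dlt0.
have : (fun t : R => t^-1 *: (f (t *: d + p) - f p)) @ 0^'+ --> 'D_d f p.
  by apply: cvg_dnbhs_at_right; exact: df.
move=> /cvgr_lt/(_ _ dlt0) H.
near=> t.
have t0 : 0 < t by near: t; exact: nbhs_right_gt.
have : t^-1 *: (f (t *: d + p) - f p) < 0 by near: t.
by rewrite /GRing.scale/= pmulr_rlt0 ?invr_gt0// subr_lt0 addrC.
Unshelve. all: by end_near. Qed.

Lemma derive_gt0_near f p d : derivable f p d -> 0 < 'D_d f p ->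
  \forall t \near 0^'+, f p < f (p + t *: d).
Proof.
move=> df dgt0; have : \forall t \near 0^'+, (- f) (p + t *: d) < (- f) p.
  by apply: derive_lt0_near; [exact: derivableN|rewrite deriveN// oppr_lt0].
by apply: filterS => t; rewrite /= !fctE ltrN2.
Qed.

Lemma near_right_line (A : set 'rV[R]_n) p d : nbhs p A ->
  \forall t \near 0^'+, A (p + t *: d).
Proof.
move=> pA; apply: (@cvg_at_right_filter _ _ (fun t : R => p + t *: d) 0) => //=.
  apply: cvgD; first exact: cvg_cst.
  exact: scalel_continuous.
by rewrite scale0r addr0.
Qed.

End directional_derivative.

(** * The orthant and the Euclidean norm *)

Section orthants.
Context {R : realType} {n : nat}.
Implicit Types (x y p : 'rV[R]_n).

Lemma open_orthant_open : open (@open_orthant R n).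
Proof.
rewrite openE => x x0.
suff : \forall y \near x, forall i : 'I_n, 0 < (y : 'rV[R]_n) ord0 i by [].
apply: (@filter_forall _ _ (fun i (y : 'rV[R]_n) => 0 < y ord0 i)
  (nbhs x) _) => i.
exact: (cvgr_gt _ (@coord_continuous R 1 n ord0 i x) _ (x0 i)).
Qed.

Lemma interior_orthant : (@orthant R n)° `<=` open_orthant.
Proof.
move=> x /nbhs_rVP[e e0 xe] i.
have := xe (x - const_mx (e / 2)); move=> /(_ _ i).
rewrite !mxE subr_ge0 => h; apply: lt_le_trans (h _); first by rewrite divr_gt0.
move=> k; rewrite !mxE opprB addrCA subrr addr0 gtr0_norm ?divr_gt0//.
by rewrite ltr_pdivrMr// ltr_pMr// ltr1n.
Qed.

Lemma boundary_orthant x : orthant x -> ~ open_orthant x -> boundary orthant x.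
Proof.
by move=> x0 Nx; split; [exact: subset_closure|move=> /interior_orthant].
Qed.

Lemma enorm_gt0 x : x != 0 -> 0 < enorm x.
Proof.
move=> /rV0Pn[i xi]; rewrite sqrtr_gt0 (bigD1 i)//= ltr_wpDr//.
  by apply: sumr_ge0 => j _; exact: sqr_ge0.
by rewrite exprn_even_gt0.
Qed.

Lemma enorm_sqr x : enorm x ^+ 2 = \sum_i x ord0 i ^+ 2.
Proof. by rewrite sqr_sqrtr// sumr_ge0// => i _; exact: sqr_ge0. Qed.

Lemma continuous_enorm_sqr : continuous (fun x : 'rV[R]_n => enorm x ^+ 2).
Proof.
have -> : (fun x : 'rV[R]_n => enorm x ^+ 2) = (fun x => \sum_i x ord0 i ^+ 2).
  by apply/funext => x; exact: enorm_sqr.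
apply: (continuous_big (op := +%R)) => [|i _ x]; first exact: add_continuous.
exact: (@continuous_comp _ _ _ (fun x : 'rV[R]_n => x ord0 i)
  (fun t => t ^+ 2) x (@coord_continuous R 1 n ord0 i x)
  (@exprn_continuous R 2 _)).
Qed.

(** Cauchy-Schwarz for the vectors of the coordinates and of their inverses,
    whose scalar product is the dimension.  It is obtained by expanding the
    squares of the differences between 1 / x_i and l x_i. *)
Lemma inv_enorm_sqr_le (x : 'rV[R]_n) : open_orthant x ->
  n%:R ^+ 2 / enorm x ^+ 2 <= \sum_i (x ord0 i)^-1 ^+ 2.
Proof.
move=> x0; rewrite enorm_sqr.
set a := \sum_i _.
have a0 : 0 <= a by apply: sumr_ge0 => i _; exact: sqr_ge0.
have [->|a_neq0] := eqVneq a 0.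
  by rewrite invr0 mulr0 sumr_ge0// => i _; exact: sqr_ge0.
have agt0 : 0 < a by rewrite lt_neqAle eq_sym a_neq0.
have key (l : R) i : 2 * l - l ^+ 2 * x ord0 i ^+ 2 <= (x ord0 i)^-1 ^+ 2.
  have := x0 i; move: (x ord0 i) => r r0; rewrite -subr_ge0.
  rewrite (_ : _ - _ = (r^-1 - l * r) ^+ 2) ?sqr_ge0//.
  by rewrite sqrrB (mulrCA r^-1) mulVf ?gt_eqF// mulr1 exprMn; ring.
(* The sum of the lower bounds is largest at l = n / a. *)
apply: le_trans (ler_sum _ (fun i _ => key (n%:R / a) i)).
rewrite big_split/= sumr_const card_ord sumrN -mulr_sumr -/a.
rewrite -[(2 * _) *+ n]mulr_natr le_eqVlt; apply/orP; left; apply/eqP.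
by field.
Qed.

End orthants.

(** * Down-closedness of the domain *)

Section down_closed.
Context {R : realType} {n : nat}.
Variable Omega : set 'rV[R]_n.
Hypothesis Omega_closed : closed Omega.
Hypothesis Omega_smooth : forall p, (boundary Omega `&` open_orthant) p ->
  smooth_boundary_at Omega p.
Hypothesis Omega_normal : forall p nu, (boundary Omega `&` open_orthant) p ->
  outer_normal Omega p nu -> forall i, 0 <= nu ord0 i.
Implicit Types (x y p d : 'rV[R]_n).

(** The normal is a positive multiple of the gradient of a local equation, so
    the sign condition passes to this gradient.  The equation vanishes at p, as
    p would be an interior point if it were negative there. *)
Lemma boundary_equation p : (boundary Omega `&` open_orthant) p ->
  exists U rho, [/\ local_defining Omega p U rho, rho p = 0,
    forall i, 0 <= grad rho p ord0 i & exists j, 0 < grad rho p ord0 j].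
Proof.
move=> Bp; have [U [rho Urho]] := Omega_smooth _ Bp.
exists U, rho; have [oU Up srho grad0 OU] := Urho.
have Op : Omega p by apply: Omega_closed; case: Bp => -[].
have grad_ge0 i : 0 <= grad rho p ord0 i.
  have /(_ i) : forall i, 0 <= ((enorm (grad rho p))^-1 *: grad rho p) ord0 i.
    by apply: Omega_normal Bp _; exists U, rho.
  by rewrite mxE pmulr_rge0// invr_gt0 enorm_gt0.
split => //.
- have OUp : (Omega `&` U) p by [].
  move: OUp; rewrite OU => -[_]; rewrite le_eqVlt => /predU1P[//|rho_lt0].
  case: Bp => -[_ +] _; case.
  have crho : {for p, continuous rho}.
    by apply: differentiable_continuous; exact: (srho [::]).
  have nU : nbhs p U by exact: open_nbhs_nbhs.
  have nrho : \forall x \near p, rho x < 0 by exact: (cvgr_lt _ crho).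
  rewrite /interior; near=> x.
  have [] // : (Omega `&` U) x.
  rewrite OU; split; first by near: x.
  by apply: ltW; near: x.
- move: grad0 => /rV0Pn[j gj]; exists j.
  by rewrite lt_neqAle eq_sym gj grad_ge0.
Unshelve. all: by end_near. Qed.

(** At a boundary point, the derivative of the local equation in the direction d
    is a sum of non-positive terms, one of which is negative.  For a direction
    with a zero coordinate the derivative could vanish, which is why strictly
    negative directions come first. *)
Lemma near_right_in x d :
  Omega x -> open_orthant x -> (forall i, d ord0 i < 0) ->
  \forall t \near 0^'+, Omega (x + t *: d).
Proof.
move=> Ox x0 d0; have [iOx|niOx] := pselect (Omega° x).
  exact: near_right_line.
have Bx : (boundary Omega `&` open_orthant) x.
  by split=> //; split=> //; exact: subset_closure.
have [U [rho [[oU Ux srho grad0 OU] rhox0 grad_ge0 [j gj]]]] :=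
  boundary_equation _ Bx.
have drho : differentiable rho x by exact: (srho [::]).
have Dlt0 : 'D_d rho x < 0.
  rewrite derive_grad// (bigD1 j)//= ltr_wnDr//.
    by apply: sumr_le0 => i _; rewrite mulr_le0_ge0// ltW.
  by rewrite nmulr_rlt0.
have nrho : \forall t \near 0^'+, rho (x + t *: d) < rho x.
  by apply: derive_lt0_near => //; exact: diff_derivable.
have nU : \forall t \near 0^'+, U (x + t *: d).
  by apply: near_right_line; exact: open_nbhs_nbhs.
near=> t; have [] // : (Omega `&` U) (x + t *: d).
rewrite OU; split; first by near: t.
by apply: ltW; rewrite -rhox0; near: t.
Unshelve. all: by end_near. Qed.

(** Otherwise there is a first time T at which the segment is about to leave
    Omega.  If the point p reached at time T is in Omega, then so is the segment
    shortly after T; if it is not, then the segment was outside Omega shortly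
    before T, because Omega is closed. *)
Lemma segment_in x d : Omega x -> open_orthant x -> (forall i, d ord0 i < 0) ->
  open_orthant (x + d) -> Omega (x + d).
Proof.
move=> Ox x0 d0 xd0.
pose N := [set t : R | 0 <= t <= 1 /\ ~ Omega (x + t *: d)].
apply: contrapT => nOxd.
have N1 : N 1 by split; [rewrite ler01 lexx|rewrite scale1r].
have lbN : lbound N 0 by move=> t [/andP[]].
have hN : has_inf N by split; [exists 1|exists 0].
pose T := inf N.
have T0 : 0 <= T by apply: lb_le_inf => //; exists 1.
have T1 : T <= 1 by apply: ge_inf => //; exists 0.
pose p := x + T *: d.
have p0 : open_orthant p.
  move=> i; rewrite !mxE; have := xd0 i; have := x0 i; have := d0 i.
  rewrite !mxE => di xi xdi; nra.
have pE s : x + s *: d = p + (s - T) *: d.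
  by rewrite /p scalerBl addrA addrAC addrK.
have [Op|nOp] := pselect (Omega p).
  have [e e0 eO] := at_right0_itv _ (near_right_in _ _ Op p0 d0).
  have [s [sT nOs] sTe] := inf_adherent e0 hN.
  have Ts : T <= s by apply: ge_inf => //; exists 0.
  move: Ts; rewrite le_eqVlt => /predU1P[Ts|Ts].
    by apply: nOs; rewrite -Ts.
  by apply: nOs; rewrite pE; apply: eO; rewrite subr_gt0 Ts ltrBlDl.
have Tgt0 : 0 < T.
  rewrite lt_neqAle T0 andbT; apply/eqP => T_0.
  by apply: nOp; rewrite /p -T_0 scale0r addr0.
have : \forall s \near T, (~` Omega) (x + s *: d).
  have : (fun s : R => x + s *: d) @ T --> p.
    by apply: cvgD; [exact: cvg_cst|exact: scalel_continuous].
  apply; apply: open_nbhs_nbhs; split => //.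
  by rewrite openC.
move=> /nbhs_ballP[e /= e0 eO].
pose s := Num.max 0 (T - e / 2).
have s0 : 0 <= s by rewrite le_max lexx.
have sT : s < T by rewrite gt_max Tgt0 gtrBl divr_gt0.
have : T <= s.
  apply: ge_inf; first by exists 0.
  split; first by rewrite s0 (le_trans (ltW sT)).
  apply: eO; rewrite /ball/= gtr0_norm ?subr_gt0// ltrBlDl -ltrBlDr.
  rewrite lt_max; apply/orP; right; rewrite ltrD2l ltrN2.
  by rewrite ltr_pdivrMr// ltr_pMr// ltr1n.
by rewrite leNgt sT.
Qed.

(** Shifting y down by a small constant s makes the direction from x to y
    strictly negative; then let s tend to 0. *)
Lemma down_closed x y : Omega x -> open_orthant x -> open_orthant y ->
  (forall i, y ord0 i <= x ord0 i) -> Omega y.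
Proof.
move=> Ox x0 y0 yx; apply: Omega_closed => B /nbhs_rVP[e e0 eB].
have /nbhs_rVP[e' e'0 e'y] : nbhs y open_orthant.
  by apply: open_nbhs_nbhs; split => //; exact: open_orthant_open.
pose s := Num.min e e' / 2.
have s0 : 0 < s by rewrite divr_gt0// lt_min e0.
have se : s < Num.min e e'.
  by rewrite ltr_pdivrMr// ltr_pMr ?ltr1n// lt_min e0.
have dist i : `|y ord0 i - (y - const_mx s) ord0 i| < Num.min e e'.
  by rewrite !mxE opprB addrCA subrr addr0 gtr0_norm.
exists (y - const_mx s); split; last first.
  by apply: eB => i; have := dist i; rewrite lt_min => /andP[].
rewrite (_ : y - _ = x + (y - const_mx s - x)); last by rewrite (addrC x) subrK.
apply: segment_in => //.
  by move=> i; rewrite !mxE; have := yx i; lra.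
rewrite (addrC x) subrK; apply: e'y => i.
by have := dist i; rewrite lt_min => /andP[].
Qed.

Lemma strictly_below_interior x y : Omega x -> open_orthant x ->
  open_orthant y -> (forall i, y ord0 i < x ord0 i) -> Omega° y.
Proof.
move=> Ox x0 y0 yx.
have ny0 : nbhs y open_orthant.
  by apply: open_nbhs_nbhs; split => //; exact: open_orthant_open.
have nyx : \forall z \near y, forall i, (z : 'rV[R]_n) ord0 i < x ord0 i.
  apply: (@filter_forall _ _ (fun i (z : 'rV[R]_n) => z ord0 i < x ord0 i)
    (nbhs y) _) => i.
  exact: (cvgr_lt _ (@coord_continuous R 1 n ord0 i y) _ (yx i)).
rewrite /interior; near=> z; apply: (down_closed x) => //.
  by near: z.
by move=> i; apply/ltW; move: i; near: z.
Unshelve. all: by end_near. Qed.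

(** Compare y with a point of Omega slightly above x. *)
Lemma interior_down_closed x y :
  Omega° x -> open_orthant x -> open_orthant y ->
  (forall i, y ord0 i <= x ord0 i) -> Omega° y.
Proof.
move=> Ox x0 y0 yx.
have nO := near_right_line _ _ (const_mx 1) Ox.
near (0 : R)^'+ => t.
have t0 : 0 < t by near: t; exact: nbhs_right_gt.
have xt i : x ord0 i < (x + t *: const_mx 1) ord0 i.
  by rewrite !mxE mulr1 ltrDl.
apply: (strictly_below_interior (x + t *: const_mx 1)) => //.
- by near: t.
- by move=> i; apply: lt_trans (x0 i) (xt i).
- by move=> i; apply: le_lt_trans (yx i) (xt i).
Unshelve. all: by end_near. Qed.

(** Where the derivative of the local equation in the direction e_j is positive,
    the line leaves Omega at once, and by down-closedness it never comes
    back. *)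
Lemma boundary_exit p : (boundary Omega `&` open_orthant) p ->
  exists j, forall t, 0 < t -> ~ Omega (p + t *: delta_mx ord0 j).
Proof.
move=> Bp.
have [U [rho [[oU Up srho grad0 OU] rhop0 grad_ge0 [j gj]]]] :=
  boundary_equation _ Bp.
exists j => t t0 Ot.
have drho : differentiable rho p by exact: (srho [::]).
have nrho : \forall s \near 0^'+, rho p < rho (p + s *: delta_mx ord0 j).
  apply: derive_gt0_near; first exact: diff_derivable.
  by move: gj; rewrite mxE.
have nU : \forall s \near 0^'+, U (p + s *: delta_mx ord0 j).
  by apply: near_right_line; exact: open_nbhs_nbhs.
have p0 : open_orthant p by case: Bp.
have shift0 s : 0 < s -> open_orthant (p + s *: delta_mx ord0 j).
  move=> s0 i; rewrite !mxE; apply: ltr_wpDr; last exact: p0.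
  by rewrite mulr_ge0 ?ler0n// ltW.
near (0 : R)^'+ => s.
have s0 : 0 < s by near: s; exact: nbhs_right_gt.
have st : s < t by near: s; exact: nbhs_right_lt.
have Os : Omega (p + s *: delta_mx ord0 j).
  apply: (down_closed (p + t *: delta_mx ord0 j)) => //; try exact: shift0.
  by move=> i; rewrite !mxE lerD2l ler_wpM2r ?ler0n// ltW.
have : rho (p + s *: delta_mx ord0 j) <= 0.
  have : (Omega `&` U) (p + s *: delta_mx ord0 j) by split => //; near: s.
  by rewrite OU => -[].
by apply/negP; rewrite -ltNge -rhop0; near: s.
Unshelve. all: by end_near. Qed.

End down_closed.

(** * Coordinate lines *)

Section coordinate_lines.
Context {R : realType} {n : nat}.
Implicit Types (i : 'I_n.+1) (y : 'rV[R]_n) (t s : R).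

Lemma row_insert_forall i t y (P : 'I_n.+1 -> R -> Prop) :
  P i t -> (forall k, P (lift i k) (y ord0 k)) ->
  forall k, P k (row_insert i (t, y) ord0 k).
Proof.
move=> Pi Py k; case: (unliftP i k) => [j|] ->.
  by rewrite row_insert_lift.
by rewrite row_insert_at.
Qed.

Lemma row_insertD i t s y :
  row_insert i (t + s, y) = row_insert i (t, y) + s *: delta_mx ord0 i.
Proof.
apply/rowP => k; rewrite !mxE/=; case: (unliftP i k) => [j|] ->/=.
  by rewrite eq_sym (negbTE (neq_lift _ _)) mulr0 addr0.
by rewrite eqxx mulr1.
Qed.

Lemma row_insert_continuous i y : continuous (fun t => row_insert i (t, y)).
Proof.
move=> t; rewrite (_ : (fun _ => _) =
    (fun s => row_insert i (0, y) + s *: delta_mx ord0 i)).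
  by apply: cvgD; [exact: cvg_cst|exact: scalel_continuous].
by apply/funext => s; rewrite -row_insertD add0r.
Qed.

Lemma is_derive_line (f : 'rV[R]_n.+1 -> R) i y t :
  differentiable f (row_insert i (t, y)) ->
  is_derive t 1 (fun s => f (row_insert i (s, y)))
    (partial i f (row_insert i (t, y))).
Proof.
move=> df.
have dfi : derivable f (row_insert i (t, y)) (delta_mx ord0 i).
  exact: diff_derivable.
have E : (fun h : R => h^-1 *: (((fun s => f (row_insert i (s, y))) \o shift t)
      (h *: (1 : R)) - f (row_insert i (t, y)))) =
    (fun h : R => h^-1 *: ((f \o shift (row_insert i (t, y)))
      (h *: delta_mx ord0 i) - f (row_insert i (t, y)))).
  apply/funext => h /=.
  by rewrite [h *: 1]mulr1 (addrC h) row_insertD (addrC (row_insert _ _)).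
apply: DeriveDef; first by rewrite /derivable E.
by rewrite /derive E.
Qed.

End coordinate_lines.

(** * Sections of the domain and the boundary null set *)

Section hardy_domain.
Context {R : realType} {n : nat}.
Variable Omega : set 'rV[R]_n.+1.
Hypothesis Omega_sub : Omega `<=` orthant.
Hypothesis Omega_compact : compact Omega.
Hypothesis Omega_smooth : forall p, (boundary Omega `&` open_orthant) p ->
  smooth_boundary_at Omega p.
Hypothesis Omega_normal : forall p nu, (boundary Omega `&` open_orthant) p ->
  outer_normal Omega p nu -> forall i, 0 <= nu ord0 i.
Variable f : 'rV[R]_n.+1 -> R.
Hypothesis f_smooth : smooth_up_to_boundary Omega f.
Hypothesis f_vanish : forall x, (Omega `&` boundary orthant) x -> f x = 0.

Let Omega_closed : closed Omega.
Proof. by apply: compact_closed => //; exact: norm_hausdorff. Qed.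

Let interior_gt0 x : Omega° x -> open_orthant x.
Proof. by move=> Ox; apply: interior_orthant; exact: (interiorS Omega_sub). Qed.

(** The section is open and bounded, and with a coordinate it contains all
    smaller positive ones; so its right end is its supremum.  An empty section
    is covered by b = 0. *)
Lemma interior_section i (y : 'rV[R]_n) :
  exists b : R, [set t | Omega° (row_insert i (t, y))] = `]0, b[%classic.
Proof.
set S := [set t | _].
have [S0|/set0P[s0 Ss0]] := eqVneq S set0.
  by exists 0; rewrite S0 set_itv_ge// bnd_simp ltxx.
have [c Oc cmax] : exists2 c, c \in Omega & forall x, x \in Omega ->
    x ord0 i <= c ord0 i.
  apply: (@EVT_max_rV R _ (fun x => x ord0 i)) => //.
    by exists (row_insert i (s0, y)); exact: interior_subset.
  apply: continuous_subspaceT; exact: coord_continuous.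
have S_ub : has_ubound S.
  exists (c ord0 i) => t St; rewrite -[t](row_insert_at _ i t y).
  by apply: cmax; rewrite inE; exact: interior_subset.
exists (sup S); apply/seteqP; split => t; rewrite /= in_itv/=.
  move=> St; apply/andP; split.
    by have := interior_gt0 _ St i; rewrite row_insert_at.
  have := near_right_line _ _ (delta_mx ord0 i) (nbhs_interior St).
  move=> /at_right0_itv[e e0 eO].
  have Ste : S (t + e / 2).
    rewrite /S/= row_insertD; apply: eO.
    by rewrite divr_gt0//= ltr_pdivrMr// ltr_pMr// ltr1n.
  apply: lt_le_trans (ub_le_sup S_ub Ste).
  by rewrite ltrDl divr_gt0.
move=> /andP[t0 tS].
have [s Ss ts] := sup_gt (ex_intro _ s0 Ss0) tS.
have s_gt0 := interior_gt0 _ Ss.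
apply: (interior_down_closed _ Omega_closed Omega_smooth Omega_normal
  (row_insert i (s, y))) => //.
  apply: (row_insert_forall i t y (fun _ r => 0 < r)) => // k.
  by have := s_gt0 (lift i k); rewrite row_insert_lift.
apply: (row_insert_forall i t y
  (fun k r => r <= row_insert i (s, y) ord0 k)) => [|k].
  by rewrite row_insert_at ltW.
by rewrite row_insert_lift.
Qed.

(** The points at which the line with direction e_j leaves Omega for good.  By
    down-closedness it is enough to test the shifts 1 / (k + 1), and countably
    many conditions keep the set measurable. *)
Definition exit_set (j : 'I_n.+1) : set 'rV[R]_n.+1 :=
  (Omega `&` open_orthant) `&`
  \bigcap_k [set p | ~ Omega (p + k.+1%:R^-1 *: delta_mx ord0 j)].

Lemma measurable_exit_set j : measurable (exit_set j).
Proof.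
apply: measurableI.
  apply: measurableI; first exact: closed_measurable_rV.
  by apply: open_measurable_rV; exact: open_orthant_open.
apply: bigcap_measurable; first by exists 0%N.
move=> k _.
rewrite (_ : [set p | _] = ~` ((fun p => p + k.+1%:R^-1 *: delta_mx ord0 j)
  @^-1` Omega)) //.
apply: measurableC; apply: closed_measurable_rV.
apply: preimage_closed => //.
move=> p _; rewrite /continuous_at; set v := _ *: _.
suff : (fun q => q + v) @ p --> p + v by [].
apply: (@cvgD R _ _ (nbhs p) _ id (cst v) p v) => //; exact: cvg_cst.
Qed.

Lemma exit_set_line j t s (y : 'rV[R]_n) : exit_set j (row_insert j (t, y)) ->
  exit_set j (row_insert j (s, y)) -> t = s.
Proof.
wlog ts : t s / t <= s.
  by move=> H Et Es; have [/H|/ltW/H] := leP t s; [exact|move=> /(_ Es Et)].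
move=> [[Ot t0] Et] [[Os s_gt0] Es].
move: ts; rewrite le_eqVlt => /predU1P[//|ts]; exfalso.
pose k := Num.truncn (s - t)^-1.
have ks : t + k.+1%:R^-1 < s.
  rewrite -ltrBrDl invf_plt ?posrE ?subr_gt0//; exact: truncnS_gt.
apply: (Et k) => //=; rewrite -row_insertD.
apply: (down_closed _ Omega_closed Omega_smooth Omega_normal
  (row_insert j (s, y))) => //.
  apply: (row_insert_forall j _ y (fun _ r => 0 < r)) => [|l].
    have := t0 j; rewrite row_insert_at => tj.
    by rewrite addr_gt0// invr_gt0.
  by have := t0 (lift j l); rewrite row_insert_lift.
apply: (row_insert_forall j _ y
  (fun l r => r <= row_insert j (s, y) ord0 l)) => [|l].
  by rewrite row_insert_at ltW.
by rewrite row_insert_lift.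
Qed.

(** The section of the set by any line with direction e_j has at most one
    point, so it is null by integration along these lines. *)
Lemma exit_set_null j : lebesgue_rV R n.+1 (exit_set j) = 0%E.
Proof.
have mE := measurable_exit_set j.
have -> : lebesgue_rV R n.+1 (exit_set j) =
    (\int[lebesgue_rV R n.+1]_x (\1_(exit_set j) x : R)%:E)%E.
  by rewrite integral_indic// setIT.
have mI : measurable_fun setT (fun x => (\1_(exit_set j) x : R)%:E).
  by apply/measurable_EFinP; exact: measurable_indic.
rewrite (integral_slice n j _ mI); last by move=> x; rewrite lee_fin.
apply: integral0_eq => y _.
have [[t0 Et0]|noE] := pselect (exists t, exit_set j (row_insert j (t, y))).
  rewrite (_ : (fun t => _) = (fun t => (\1_[set t0] t)%:E)).
    rewrite integral_indic// setIT; exact: lebesgue_measure_set1.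
  apply/funext => t; congr (_%:E); rewrite !indicE; congr (_%:R).
  congr nat_of_bool.
  apply/idP/idP; rewrite !inE; last by move=> ->.
  by move=> Et; exact: exit_set_line Et Et0.
apply: integral0_eq => t _.
by rewrite indicE memNset// => Et; apply: noE; exists t.
Qed.

Definition exits : set 'rV[R]_n.+1 := \big[setU/set0]_(j < n.+1) exit_set j.

Lemma measurable_exits : measurable exits.
Proof. by apply: bigsetU_measurable => j _; exact: measurable_exit_set. Qed.

Lemma exits_null : lebesgue_rV R n.+1 exits = 0%E.
Proof.
suff [] : measurable exits /\ lebesgue_rV R n.+1 exits = 0%E by [].
rewrite /exits; elim/big_ind : _ => [|A B [mA A0] [mB B0]|j _].
- by split => //; exact: measure0.
- by split; [exact: measurableU|rewrite measureU0].
- by split; [exact: measurable_exit_set|exact: exit_set_null].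
Qed.

Lemma not_exit_interior x : Omega x -> open_orthant x -> ~ exits x -> Omega° x.
Proof.
move=> Ox x0 nEx; apply: contrapT => niOx; apply: nEx.
have Bx : (boundary Omega `&` open_orthant) x.
  by split=> //; split=> //; exact: subset_closure.
have [j jO] := boundary_exit _ Omega_closed Omega_smooth Omega_normal _ Bx.
rewrite /exits (bigD1 j)//=; left; split => // k _ /=.
by apply: jO; rewrite invr_gt0.
Qed.

(** * The Hardy inequality on the domain *)

Lemma partial_bounded i : exists2 M : R, 0 <= M &
  forall x, Omega° x -> `|partial i f x| <= M.
Proof.
have [_ _ /(_ [:: i])[g cg gE]] := f_smooth.
have [M [_ MP]] := compact_bounded (continuous_compact cg Omega_compact).
exists `|M + 1| => // x Ox; rewrite -[partial i f x](gE _ Ox).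
rewrite (le_trans _ (ler_norm _))//; apply: MP; first by rewrite ltrDl.
by exists x => //; exact: interior_subset.
Qed.

(** The mean value theorem between s and t, where s tends to 0.  The limit point
    with coordinate 0 is in Omega and on the boundary of the orthant, so that f
    vanishes there, and f is continuous on Omega. *)
Lemma line_bound i (y : 'rV[R]_n) (M b : R) : 0 <= M ->
  (forall x, Omega° x -> `|partial i f x| <= M) ->
  [set t | Omega° (row_insert i (t, y))] = `]0, b[%classic ->
  {in `]0, b[, forall t, `|f (row_insert i (t, y))| <= M * t}.
Proof.
move=> M0 fM Sb t tb.
have Sin s : s \in `]0, b[ -> Omega° (row_insert i (s, y)).
  by move=> sb; have : `]0, b[%classic s by []; rewrite -Sb.
have /andP[t0 t_lt] : 0 < t < b by rewrite in_itv/= in tb.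
pose p0 := row_insert i (0, y).
have lineE s : p0 + s *: delta_mx ord0 i = row_insert i (s, y).
  by rewrite -row_insertD add0r.
have near_line (A : set 'rV[R]_n.+1) : nbhs p0 A ->
    \forall s \near 0^'+, A (row_insert i (s, y)).
  move=> /(near_right_line _ _ (delta_mx ord0 i)).
  by apply: filterS => s; rewrite lineE.
have itv s : 0 < s -> s <= t -> s \in `]0, b[.
  by move=> s0 st; rewrite in_itv/= s0 (le_lt_trans st).
have Op0 : Omega p0.
  apply: Omega_closed => B /near_line nB.
  near (0 : R)^'+ => s; exists (row_insert i (s, y)); split; last by near: s.
  apply: (@interior_subset _ Omega); apply: Sin; apply: itv; near: s.
    exact: nbhs_right_gt.
  exact: nbhs_right_le.
have fp0 : f p0 = 0.
  apply: f_vanish; split => //; apply: boundary_orthant; first exact: Omega_sub.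
  by move=> /(_ i); rewrite row_insert_at ltxx.
apply/ler_addgt0Pr => e e0.
have [/subspace_continuousP/(_ _ Op0) cf sf _] := f_smooth.
have : nbhs p0 [set x | Omega x -> `|f p0 - f x| < e].
  by have /cvgrPdist_lt/(_ _ e0) := cf; apply.
move=> /near_line nf.
near (0 : R)^'+ => s.
have s0 : 0 < s by near: s; exact: nbhs_right_gt.
have st : s < t by near: s; exact: nbhs_right_lt.
have fs : `|f (row_insert i (s, y))| < e.
  rewrite -normrN -[- _]add0r -[in ltLHS]fp0.
  have : Omega (row_insert i (s, y)).
    apply: (@interior_subset _ Omega); apply: Sin; apply: itv => //.
    exact: ltW.
  by near: s.
pose h (u : R) := f (row_insert i (u, y)).
pose h' (u : R) := partial i f (row_insert i (u, y)).
have dh r : r \in `[s, t] -> is_derive (r : R) 1 h (h' r).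
  rewrite in_itv/= => /andP[sr rt]; apply: is_derive_line.
  by apply: (sf [::]); apply: Sin; apply: itv => //; exact: lt_le_trans sr.
have dh_oo r : r \in `]s, t[ -> is_derive (r : R) 1 h (h' r).
  by move=> /subset_itv_oo_cc; exact: dh.
have ch : {within `[s, t], continuous h}.
  by apply: derivable_within_continuous => r /dh[].
have [c cst E] := MVT st dh_oo ch.
have cM : `|partial i f (row_insert i (c, y))| <= M.
  apply: fM; apply: Sin; apply: itv; move: cst; rewrite in_itv/=.
    by move=> /andP[+ _]; exact: lt_trans.
  by move=> /andP[_ /ltW].
rewrite -[f (row_insert i (t, y))](subrK (f (row_insert i (s, y)))).
rewrite (le_trans (ler_normD _ _))// lerD// ?(ltW fs)//.
rewrite -/(h t) -/(h s) E normrM ler_pM// gtr0_norm ?subr_gt0//.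
by rewrite gerBl ltW.
Unshelve. all: by end_near. Qed.

Lemma measurable_quotient i :
  measurable_fun Omega° (fun x => ((f x / x ord0 i) ^+ 2)%:E).
Proof.
have [_ sf _] := f_smooth.
apply/measurable_EFinP/measurable_funX.
apply: open_continuous_measurable_rV; first exact: open_interior.
move=> x; rewrite inE => Ox.
apply: (@continuousM R _ f (fun z => (z ord0 i)^-1) x).
  by apply: differentiable_continuous; exact: (sf [::]).
apply: (@continuousV R _ (fun z : 'rV[R]_n.+1 => z ord0 i) x);
  last exact: coord_continuous.
by rewrite gt_eqF// interior_gt0.
Qed.

Lemma measurable_partial i : measurable_fun Omega° (partial i f).
Proof.
have [_ sf _] := f_smooth.
apply: open_continuous_measurable_rV; first exact: open_interior.
move=> x; rewrite inE => Ox.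
by apply: differentiable_continuous; exact: (sf [:: i]).
Qed.

Lemma measurable_partial_sqr i :
  measurable_fun Omega° (fun x => (4 * partial i f x ^+ 2)%:E).
Proof.
apply/measurable_EFinP; apply: measurable_funM; first exact: measurable_cst.
by apply: measurable_funX; exact: measurable_partial.
Qed.

Lemma hardy_direction i :
  (\int[lebesgue_rV R n.+1]_(x in Omega°) ((f x / x ord0 i) ^+ 2)%:E <=
   \int[lebesgue_rV R n.+1]_(x in Omega°) (4 * partial i f x ^+ 2)%:E)%E.
Proof.
have [_ sf _] := f_smooth.
have mO : measurable Omega° by apply: open_measurable_rV; exact: open_interior.
rewrite (integral_mkcond Omega°) [leRHS](integral_mkcond Omega°).
set F := _ \_ _; set G := _ \_ _.
have F0 x : (0 <= F x)%E.
  by apply: erestrict_ge0 => z _; rewrite lee_fin sqr_ge0.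
have G0 x : (0 <= G x)%E.
  by apply: erestrict_ge0 => z _; rewrite lee_fin mulr_ge0// sqr_ge0.
have mF : measurable_fun setT F.
  exact: ((measurable_restrictT _ mO).1 (measurable_quotient i)).
have mG : measurable_fun setT G.
  exact: ((measurable_restrictT _ mO).1 (measurable_partial_sqr i)).
rewrite (integral_slice n i F mF F0) (integral_slice n i G mG G0).
apply: ge0_le_integral => //.
- by move=> y _; exact: integral_ge0.
- exact: measurable_slice.
- exact: measurable_slice.
move=> y _.
have [b Sb] := interior_section i y.
have Sin s : s \in `]0, b[ -> Omega° (row_insert i (s, y)).
  by move=> sb; have : `]0, b[%classic s by []; rewrite -Sb.
have memE t : (row_insert i (t, y) \in (Omega° : set _)) =
    (t \in `]0, b[%classic).
  by rewrite -Sb; apply/idP/idP => /set_mem Ot; exact/mem_set.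
have patchE (u : 'rV[R]_n.+1 -> \bar R) :
    (fun t => (u \_ Omega°) (row_insert i (t, y))) =
    (fun t => u (row_insert i (t, y))) \_ `]0, b[%classic.
  by apply/funext => t; rewrite /patch memE.
rewrite /F /G !patchE -!integral_mkcond.
have [M M0 fM] := partial_bounded i.
have quotE : (fun t => ((f (row_insert i (t, y)) /
      row_insert i (t, y) ord0 i) ^+ 2)%:E) =
    (fun t => ((f (row_insert i (t, y)) / t) ^+ 2)%:E).
  by apply/funext => t; rewrite row_insert_at.
rewrite quotE.
apply: (hardy_itv b M (fun t => f (row_insert i (t, y)))
  (fun t => partial i f (row_insert i (t, y)))).
- by move=> t /Sin Ot; apply: is_derive_line; exact: (sf [::]).
- move=> t /Sin Ot; apply: (@continuous_comp _ _ _
    (fun t => row_insert i (t, y)) (partial i f)).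
    exact: row_insert_continuous.
  by apply: differentiable_continuous; exact: (sf [:: i]).
- exact: line_bound.
Qed.

Let E := Omega `&` open_orthant.

Let mE : measurable E.
Proof.
apply: measurableI; first exact: closed_measurable_rV.
by apply: open_measurable_rV; exact: open_orthant_open.
Qed.

Let interior_sub_E : Omega° `<=` E.
Proof. by move=> x Ox; split; [exact: interior_subset|exact: interior_gt0]. Qed.

Lemma measurable_integrand :
  measurable_fun E (fun x => (f x ^+ 2 / enorm x ^+ 2)%:E).
Proof.
have [cf _ _] := f_smooth.
apply/measurable_EFinP; apply: measurable_funM.
  apply: measurable_funX; apply: within_continuous_measurable_rV => //.
  by apply: continuous_subspaceW cf; exact: subIsetl.
apply: (@measurable_funS _ _ _ _ open_orthant).
- by apply: open_measurable_rV; exact: open_orthant_open.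
- exact: subIsetr.
apply: open_continuous_measurable_rV; first exact: open_orthant_open.
move=> x; rewrite inE => x0.
apply: (@continuousV R _ (fun z : 'rV[R]_n.+1 => enorm z ^+ 2) x);
  last exact: continuous_enorm_sqr.
rewrite sqrf_eq0 gt_eqF// enorm_gt0//; apply/eqP => x_eq0.
by have := x0 ord0; rewrite x_eq0 mxE ltxx.
Qed.

(** On the boundary of the orthant the integrand vanishes, and what remains of
    the boundary is contained in the null set of exit points. *)
Lemma integral_quotient_interior :
  (\int[lebesgue_rV R n.+1]_(x in Omega) (f x ^+ 2 / enorm x ^+ 2)%:E <=
   \int[lebesgue_rV R n.+1]_(x in Omega°) (f x ^+ 2 / enorm x ^+ 2)%:E)%E.
Proof.
set u := fun x => (f x ^+ 2 / enorm x ^+ 2)%:E.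
have u0 x : (0 <= u x)%E by rewrite lee_fin divr_ge0// sqr_ge0.
have -> : (\int[lebesgue_rV R n.+1]_(x in Omega) u x =
    \int[lebesgue_rV R n.+1]_(x in E) u x)%E.
  rewrite integral_mkcondr; apply: eq_integral => x; rewrite inE => Ox.
  rewrite /patch; case: ifPn => // /negP; rewrite inE => x0.
  rewrite /u f_vanish ?expr0n ?mul0r//; split => //.
  by apply: boundary_orthant => //; exact: Omega_sub.
rewrite (ge0_negligible_integral measurable_exits mE
  measurable_integrand (fun x _ => u0 x)); last exact: exits_null.
apply: le_integral_subset; last by move=> x _; exact: u0.
move=> x [[Ox x0] nx].
exact: not_exit_interior nx.
Qed.

Lemma hardy_interior :
  (\int[lebesgue_rV R n.+1]_(x in Omega°) (f x ^+ 2 / enorm x ^+ 2)%:E <=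
   (4 / n.+1%:R ^+ 2)%:E *
   \int[lebesgue_rV R n.+1]_(x in Omega°) (enorm (grad f x) ^+ 2)%:E)%E.
Proof.
have mO : measurable Omega° by apply: open_measurable_rV; exact: open_interior.
have c0 : 0 <= (n.+1%:R ^+ 2)^-1 :> R by rewrite invr_ge0 sqr_ge0.
pose q i x := (f x / x ord0 i) ^+ 2.
pose p i x := 4 * partial i f x ^+ 2.
have q0 i x : (0 <= (q i x)%:E)%E by rewrite lee_fin sqr_ge0.
have p0 i x : (0 <= (p i x)%:E)%E by rewrite lee_fin mulr_ge0// sqr_ge0.
have mq i : measurable_fun Omega° (fun x => (q i x)%:E).
  exact: measurable_quotient.
have mp i : measurable_fun Omega° (fun x => (p i x)%:E).
  exact: measurable_partial_sqr.
have mf : measurable_fun Omega° (fun x => (f x ^+ 2 / enorm x ^+ 2)%:E).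
  exact: measurable_funS mE interior_sub_E measurable_integrand.
have sum_p x : \sum_i (p i x)%:E = (4 * enorm (grad f x) ^+ 2)%:E.
  rewrite sumEFin enorm_sqr mulr_sumr.
  by congr (_%:E); apply: eq_bigr => i _; rewrite mxE.
have m_grad : measurable_fun Omega° (fun x => (enorm (grad f x) ^+ 2)%:E).
  rewrite (_ : (fun x => _) = (fun x => (\sum_i partial i f x ^+ 2)%:E)).
    apply/measurable_EFinP; apply: measurable_sum => i.
    by apply: measurable_funX; exact: measurable_partial.
  apply/funext => x; rewrite enorm_sqr.
  by congr (_%:E); apply: eq_bigr => i _; rewrite mxE.
have -> : ((4 / n.+1%:R ^+ 2)%:E *
    \int[lebesgue_rV R n.+1]_(x in Omega°) (enorm (grad f x) ^+ 2)%:E =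
    ((n.+1%:R ^+ 2)^-1)%:E *
    \sum_i \int[lebesgue_rV R n.+1]_(x in Omega°) (p i x)%:E)%E.
  rewrite -ge0_integral_sum//.
  under [in RHS]eq_integral do rewrite sum_p EFinM.
  rewrite ge0_integralZl_EFin//; last by move=> x _; rewrite lee_fin sqr_ge0.
  by rewrite muleA -EFinM mulrC.
apply: (@le_trans _ _ (((n.+1%:R ^+ 2)^-1)%:E *
    \sum_i \int[lebesgue_rV R n.+1]_(x in Omega°) (q i x)%:E)%E); last first.
  rewrite lee_wpmul2l ?lee_fin//; apply: lee_sum => i _.
  exact: hardy_direction.
rewrite -ge0_integral_sum// -ge0_integralZl_EFin//; last 2 first.
- by move=> x _; exact: sume_ge0.
- exact: emeasurable_sum.
apply: ge0_le_integral => //.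
- by move=> x _; rewrite lee_fin divr_ge0// sqr_ge0.
- by apply: emeasurable_funM => //; exact: emeasurable_sum.
move=> x Ox; rewrite sumEFin -EFinM lee_fin.
have x0 := interior_gt0 _ Ox.
have -> : \sum_i q i x = f x ^+ 2 * \sum_i (x ord0 i)^-1 ^+ 2.
  by rewrite mulr_sumr; apply: eq_bigr => i _; rewrite /q exprMn.
rewrite mulrCA ler_wpM2l ?sqr_ge0// -ler_pdivrMl ?invr_gt0 ?exprn_gt0//.
by rewrite invrK; exact: inv_enorm_sqr_le.
Qed.

End hardy_domain.

Theorem theorem7 (R : realType) (n : nat) (Omega : set 'rV[R]_n)
    (f : 'rV[R]_n -> R)
    (n_ge2 : (2 <= n)%N)
    (Omega_sub : Omega `<=` orthant)
    (Omega_compact : compact Omega)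
    (Omega_connected : connected Omega)
    (Omega_int : Omega° !=set0)
    (Omega_domain : connected (Omega `&` open_orthant))
    (Omega_smooth : forall p, (boundary Omega `&` open_orthant) p ->
      smooth_boundary_at Omega p)
    (Omega_normal : forall p nu, (boundary Omega `&` open_orthant) p ->
      outer_normal Omega p nu -> forall i, 0 <= nu ord0 i)
    (f_smooth : smooth_up_to_boundary Omega f)
    (f_vanish : forall x, (Omega `&` boundary orthant) x -> f x = 0) :
  (\int[lebesgue_rV R n]_(x in Omega) (f x ^+ 2 / enorm x ^+ 2)%:E <=
   (4 / n%:R ^+ 2)%:E *
   \int[lebesgue_rV R n]_(x in Omega) (enorm (grad f x) ^+ 2)%:E)%E.
Proof.
case: n => [//|n] in Omega f n_ge2 Omega_sub Omega_compact Omega_connected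
  Omega_int Omega_domain Omega_smooth Omega_normal f_smooth f_vanish *.
apply: le_trans (integral_quotient_interior Omega Omega_sub Omega_compact
  Omega_smooth Omega_normal f f_smooth f_vanish) _.
apply: le_trans (hardy_interior Omega Omega_sub Omega_compact
  Omega_smooth Omega_normal f f_smooth f_vanish) _.
rewrite lee_wpmul2l ?lee_fin ?divr_ge0 ?sqr_ge0//.
apply: le_integral_subset; first exact: interior_subset.
by move=> x _; rewrite lee_fin sqr_ge0.
Qed.
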